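(* Let $n$ be a nonnegative integer. Then there exists an integer $u\geq 0$ such that for every integer $v\geq 1$ and all distinct primes $q_1,\ldots,q_{u+v}$ coprime to $6$, we have \[ \overline{b}_3\left(\frac{q_1\cdots q_{u+v}\cdot n-24}{24}\right)\equiv 0\pmod{2^v} \] whenever $n$ is coprime to $q_1,\ldots,q_{u+v}$.
   Context: For $|q|<1$ and integers $n\geq 1$, write $f_n:=\prod_{j=1}^{\infty}(1-q^{nj})$. The numbers $\overline{b}_3(n)$ are defined by \[ \sum_{n=0}^{\infty}\overline{b}_3(n)q^n=\frac{f_2f_3^3f_{12}^3}{f_1f_4f_{6}^3}, \] (equivalently $\psi^3(-q^3)/\psi(-q)$ with $\psi(q)=\sum_{n\ge0}q^{n(n+1)/2}$), and by convention $\overline{b}_3(x)=0$ whenever $x$ is not a nonnegative integer. *)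

(* Defs.v *)
From HB Require Import structures.
From mathcomp Require Import all_boot all_order all_algebra.
From mathcomp Require boolp.

Set Implicit Arguments.
Unset Strict Implicit.
Unset Printing Implicit Defensive.

Import GRing.Theory.
Local Open Scope ring_scope.

(* Formal power series over [R], given by their coefficient sequence.  This is
   a record rather than an alias of [nat -> R] because MathComp-Analysis puts
   the pointwise ring structure on function types. *)
Record fps (R : Type) := Fps { fps_coef :> nat -> R }.

Lemma fpsP (R : Type) (a b : fps R) : (forall n, a n = b n) -> a = b.
Proof. by case: a b => [a] [b] /= ab; congr Fps; apply/boolp.funext. Qed.

HB.instance Definition _ (R : Type) := boolp.gen_eqMixin (fps R).
HB.instance Definition _ (R : Type) := boolp.gen_choiceMixin (fps R).

Section FpsZmod.
Context (R : zmodType).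
Implicit Types a b : fps R.

Definition fps_zero : fps R := Fps (fun _ => 0).
Definition fps_opp a : fps R := Fps (fun n => - a n).
Definition fps_add a b : fps R := Fps (fun n => a n + b n).

Fact fps_addA : associative fps_add.
Proof. by move=> a b c; apply: fpsP => n /=; rewrite addrA. Qed.
Fact fps_addC : commutative fps_add.
Proof. by move=> a b; apply: fpsP => n /=; rewrite addrC. Qed.
Fact fps_add0 : left_id fps_zero fps_add.
Proof. by move=> a; apply: fpsP => n /=; rewrite add0r. Qed.
Fact fps_addN : left_inverse fps_zero fps_opp fps_add.
Proof. by move=> a; apply: fpsP => n /=; rewrite addNr. Qed.

HB.instance Definition _ :=
  GRing.isZmodule.Build (fps R) fps_addA fps_addC fps_add0 fps_addN.

Lemma fps_coef0 n : (0 : fps R) n = 0. Proof. by []. Qed.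
Lemma fps_coefD a b n : (a + b) n = a n + b n. Proof. by []. Qed.
Lemma fps_coefN a n : (- a) n = - a n. Proof. by []. Qed.
Lemma fps_coefB a b n : (a - b) n = a n - b n. Proof. by []. Qed.

End FpsZmod.

Section FpsRing.
Context (R : comNzRingType).
Implicit Types a b c : fps R.

Definition fps_const (x : R) : fps R := Fps (fun n => if n is 0%N then x else 0).
Definition fps_mul a b : fps R :=
  Fps (fun n => \sum_(i < n.+1) a i * b (n - i)%N).

Definition fps_trunc (N : nat) a : {poly R} := \poly_(i < N) a i.

Lemma coef_fps_mul (N : nat) a b n : (n < N)%N ->
  fps_mul a b n = (fps_trunc N a * fps_trunc N b)`_n.
Proof.
move=> nN; rewrite coefM /=; apply: eq_bigr => i _.
have iN : (i < N)%N by rewrite (leq_ltn_trans _ nN) // -ltnS.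
by rewrite !coef_poly iN (leq_ltn_trans (leq_subr _ _) nN).
Qed.

Fact fps_mulC : commutative fps_mul.
Proof. by move=> a b; apply: fpsP => n; rewrite !(coef_fps_mul _ _ (ltnSn n)) mulrC. Qed.

Lemma coef_fps_mulA a b c n :
  fps_mul (fps_mul a b) c n
  = (fps_trunc n.+1 a * fps_trunc n.+1 b * fps_trunc n.+1 c)`_n.
Proof.
rewrite coefM; apply: eq_bigr => i _; rewrite (coef_fps_mul _ _ (ltn_ord i)).
by rewrite [(fps_trunc _ c)`_ _]coef_poly ltnS leq_subr.
Qed.

Fact fps_mulA : associative fps_mul.
Proof.
move=> a b c; apply: fpsP => n.
by rewrite [fps_mul a _]fps_mulC !coef_fps_mulA mulrC mulrA.
Qed.

Fact fps_mul1 : left_id (fps_const 1) fps_mul.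
Proof.
move=> a; apply: fpsP => n /=; rewrite big_ord_recl /= mul1r subn0.
by rewrite big1 ?addr0 // => i _; rewrite mul0r.
Qed.

Fact fps_mulD : left_distributive fps_mul (fun a b => a + b).
Proof.
move=> a b c; apply: fpsP => n /=; rewrite -big_split /=.
by apply: eq_bigr => i _; rewrite mulrDl.
Qed.

Fact fps_one_neq0 : fps_const 1 != 0.
Proof.
apply/eqP => /(congr1 (fun a : fps R => a 0%N)) /= /eqP.
by rewrite oner_eq0.
Qed.

HB.instance Definition _ := GRing.Zmodule_isComNzRing.Build (fps R)
  fps_mulA fps_mulC fps_mul1 fps_mulD fps_one_neq0.

Lemma fps_coef1 n : (1 : fps R) n = (n == 0%N)%:R.
Proof. by case: n. Qed.
Lemma fps_coefM a b n : (a * b) n = \sum_(i < n.+1) a i * b (n - i)%N.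
Proof. by []. Qed.
Lemma fps_coefM0 a b : (a * b) 0%N = a 0%N * b 0%N.
Proof. by rewrite fps_coefM big_ord1. Qed.
Lemma fps_coef_sum (I : Type) (r : seq I) (P : pred I) (F : I -> fps R) n :
  (\sum_(i <- r | P i) F i) n = \sum_(i <- r | P i) F i n.
Proof. by elim/big_rec2: _ => // i x y _ <-. Qed.

Lemma fps_coefX_small a k n : a 0%N = 0 -> (n < k)%N -> (a ^+ k) n = 0.
Proof.
move=> a0; elim: k n => // k IHk n; rewrite ltnS => nk.
rewrite exprS fps_coefM big1 // => -[[|i] iP] _ /=; first by rewrite a0 mul0r.
by rewrite IHk ?mulr0 // (leq_trans _ nk) // ltn_subrL /=; case: n iP {nk}.
Qed.

End FpsRing.

Section FpsUnit.
Context (R : comUnitRingType).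
Implicit Types a b : fps R.

Definition fps_unit : {pred fps R} := fun a => a 0%N \is a GRing.unit.

(* With [c := (a 0)^-1], the geometric series [c * \sum_k (1 - c * a) ^+ k];
   the terms with [k > n] do not contribute to the coefficient of index [n]. *)
Definition fps_geom a n : fps R :=
  let c := fps_const (a 0%N)^-1 in
  c * \sum_(k < n.+1) (1 - c * a) ^+ k.
Definition fps_inv a : fps R :=
  if a \in fps_unit then Fps (fun n => fps_geom a n n) else a.

Fact fps_mulVx : {in fps_unit, left_inverse 1 fps_inv *%R}.
Proof.
move=> a aU; rewrite mulrC /fps_inv aU; apply: fpsP => n.
set c := fps_const (a 0%N)^-1; set g := 1 - c * a.
have g0 : g 0%N = 0.
  by rewrite fps_coefB fps_coefM0 fps_coef1 /= mulVr ?subrr.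
have geomE m : (m <= n)%N -> fps_geom a m m = fps_geom a n m.
  move=> mn; rewrite /fps_geom -/c -/g !fps_coefM.
  apply: eq_bigr => i _; congr (_ * _); rewrite !fps_coef_sum.
  rewrite -!(big_mkord xpredT (fun k => (g ^+ k) (m - i)%N)).
  rewrite [RHS](big_cat_nat _ (n := m.+1)) //=.
  rewrite [X in _ = _ + X]big_nat [X in _ = _ + X]big1 ?addr0 // => k /andP[mk _].
  apply: fps_coefX_small => //.
  by rewrite (leq_ltn_trans (leq_subr _ _)).
transitivity ((a * fps_geom a n) n).
  by rewrite !fps_coefM; apply: eq_bigr => i _; congr (_ * _); apply/geomE/leq_subr.
have -> : a * fps_geom a n = 1 - g ^+ n.+1.
  rewrite /fps_geom -/c -/g -[RHS]opprB subrX1 -mulNr opprB mulrA [a * c]mulrC.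
  by rewrite /g subKr.
by rewrite fps_coefB fps_coefX_small // subr0.
Qed.

Fact fps_unitPl a b : b * a = 1 -> fps_unit a.
Proof.
move=> /(congr1 (fun c : fps R => c 0%N)); rewrite fps_coefM0 /= => ba1.
by apply/unitrPr; exists (b 0%N); rewrite mulrC.
Qed.

Fact fps_inv_out : {in [predC fps_unit], fps_inv =1 id}.
Proof. by move=> a; rewrite inE /fps_inv => /negPf ->. Qed.

HB.instance Definition _ := GRing.ComNzRing_hasMulInverse.Build (fps R)
  fps_mulVx fps_unitPl fps_inv_out.

Lemma fps_unitE a : (a \is a GRing.unit) = (a 0%N \is a GRing.unit).
Proof. by []. Qed.

End FpsUnit.

(* The infinite product [f_n], for [n >= 1]: since [n * j > m] for [j > m], the
   coefficient of index [m] is that of the product of the factors with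
   [1 <= j <= m] (see [eulerf_coef]). *)
Definition euler_prod (n N : nat) : {poly int} :=
  \prod_(1 <= j < N.+1) (1 - 'X^(n * j)).
Definition eulerf (n : nat) : fps int := Fps (fun m => (euler_prod n m)`_m).

Lemma eulerf_coef (n m N : nat) : (0 < n)%N -> (m <= N)%N ->
  eulerf n m = (euler_prod n N)`_m.
Proof.
move=> n0; elim: N => [|N IHN]; first by rewrite leqn0 => /eqP ->.
rewrite leq_eqVlt => /orP[/eqP -> //|mN].
rewrite IHN // /euler_prod [in RHS]big_nat_recr //= mulrBr mulr1 coefB coefMXn.
by rewrite (leq_trans mN) ?subr0 // leq_pmull.
Qed.

Lemma eulerf_unit (n : nat) : eulerf n \is a GRing.unit.
Proof. by rewrite fps_unitE /= /euler_prod big_geq // coef1. Qed.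

Definition b3bar_gf : fps int :=
  (eulerf 2 * eulerf 3 ^+ 3 * eulerf 12 ^+ 3)
  / (eulerf 1 * eulerf 4 * eulerf 6 ^+ 3).

(* Indexed by rationals, with value 0 off the nonnegative integers; for
   [x = n%:R] with [n : nat], [Num.truncn x = n]. *)
Definition b3bar (x : rat) : int :=
  if x \is a Num.nat then b3bar_gf (Num.truncn x) else 0.

Lemma b3bar_nat (n : nat) : b3bar n%:R = b3bar_gf n.
Proof. by rewrite /b3bar Num.Theory.natr_nat Num.Theory.natrK. Qed.

(* Main.v *)
(* The coefficient of q^n in psi(-q^3)^3 / psi(-q) is
   (-1)^n * \sum_(d | n+1, (n+1)/d odd) chi(d), with chi the character mod 3.
   An odd prime p not dividing n+1 multiplies this divisor sum by 1 + chi(p),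
   which is 0 or 2 when p <> 3; hence u = 0 works.

   The Lambert series comes from a finite form of Kronecker's identity
     \sum_(k in Z) x^k / (1 - y Q^k)
       = (Q;Q)^2 (xy;Q) (Q/xy;Q) / ((x;Q) (Q/x;Q) (y;Q) (Q/y;Q)),
   in the case Q = x^2, where it is a partial fraction decomposition with simple
   coefficients: Lagrange interpolation of \prod_(j < M) (z - x Q^j) at the nodes
   1, Q, .., Q^M.  One takes x = - q^3, y = q^2 and lets M tend to infinity in
   the q-adic sense. *)
Require Import Defs.
From HB Require Import structures.
From mathcomp Require Import all_boot all_order all_algebra.
From mathcomp Require boolp.
From mathcomp Require Import ring zify.
Set Implicit Arguments.
Unset Strict Implicit.
Unset Printing Implicit Defensive.
Import GRing.Theory.
Local Open Scope ring_scope.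

(** * A finite Kronecker identity by Lagrange interpolation *)

Section FiniteKronecker.
Context (R : idomainType) (x : R).
Let Q := x ^+ 2.

(** The Pochhammer quotient (x;Q)_m / (Q;Q)_m. *)
Definition qratio (m : nat) : R := \prod_(i < m) ((1 - x * Q ^+ i) / (1 - Q ^+ i.+1)).

Hypothesis QU : forall i, 1 - Q ^+ i.+1 \is a GRing.unit.

(** Here Q = x^2 is essential: after reversing the product, Q^(j+1) - x = - x (1 - x Q^j), so the
    factors below index k produce the same quotient [qratio] as those above it. *)
Lemma prod_below k :
  \prod_(j < k) (Q ^+ k - x * Q ^+ j) = x ^+ k * qratio k * \prod_(j < k) (Q ^+ k - Q ^+ j).
Proof.
rewrite -[in x ^+ k](card_ord k) -prodr_const -!big_split /=.
rewrite (reindex_inj rev_ord_inj) [RHS]big_split [X in _ = _ * X](reindex_inj rev_ord_inj).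
rewrite -big_split /=; apply: eq_bigr => j _.
have -> : Q ^+ k = Q ^+ (k - j.+1) * Q ^+ j.+1 by rewrite -exprD subnK.
have -> : Q ^+ (k - j.+1) * Q ^+ j.+1 - Q ^+ (k - j.+1) = - Q ^+ (k - j.+1) * (1 - Q ^+ j.+1).
  by ring.
set a := 1 - Q ^+ j.+1.
rewrite (_ : x * (_ / a) * _ = - x * (1 - x * Q ^+ j) * Q ^+ (k - j.+1) * (a^-1 * a)); last by ring.
rewrite mulVr ?QU // mulr1.
by rewrite exprS /Q; ring.
Qed.

Lemma prod_above k l :
  \prod_(j < l) (Q ^+ k - x * Q ^+ (k + j)) = qratio l * \prod_(j < l) (Q ^+ k - Q ^+ (k.+1 + j)).
Proof.
rewrite -big_split /=; apply: eq_bigr => j _.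
have -> : Q ^+ k - Q ^+ (k.+1 + j) = Q ^+ k * (1 - Q ^+ j.+1).
  by rewrite addSnnS exprD; ring.
by rewrite mulrCA -!mulrA mulVr // mulr1 exprD; ring.
Qed.

(** For k <= M, the unnormalised Lagrange basis polynomial at the node Q^k: the factors z - Q^j with
    j <= M, j <> k, split at k to avoid a division. *)
Definition node_prod (M k : nat) (z : R) :=
  \prod_(j < k) (z - Q ^+ j) * \prod_(j < M - k) (z - Q ^+ (k.+1 + j)).

Lemma node_prodM M k z : (k <= M)%N ->
  node_prod M k z * (z - Q ^+ k) = \prod_(j < M.+1) (z - Q ^+ j).
Proof.
move=> kM; rewrite /node_prod.
rewrite -[in RHS](big_mkord xpredT (fun j => z - Q ^+ j)).
rewrite (big_cat_nat (n := k)) //=; last exact: leqW.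
rewrite big_mkord mulrAC -mulrA; congr (_ * _).
rewrite big_ltn ?ltnS //; congr (_ * _).
rewrite -[X in index_iota X]add0n big_addn big_mkord subSS.
by apply: eq_bigr => j _; rewrite addnC.
Qed.

Hypothesis Q_inj : injective (fun i => Q ^+ i).

(** Both sides have degree at most M in z and agree at the M + 1 distinct nodes: at z = Q^k only the
    term of index k survives on the right, and the left side splits into [prod_below] and
    [prod_above]. *)
Lemma interpolation M z :
  \prod_(j < M) (z - x * Q ^+ j) =
  \sum_(k < M.+1) x ^+ k * qratio k * qratio (M - k) * node_prod M k z.
Proof.
pose L : {poly R} := \prod_(j < M) ('X - (x * Q ^+ j)%:P).
pose E k : {poly R} := \prod_(j < k) ('X - (Q ^+ j)%:P)
   * \prod_(j < M - k) ('X - (Q ^+ (k.+1 + j))%:P).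
pose D := L - \sum_(k < M.+1) (x ^+ k * qratio k * qratio (M - k)) *: E k.
have EE k w : (E k).[w] = node_prod M k w.
  rewrite /E hornerM !horner_prod; congr (_ * _);
  by apply: eq_bigr => j _; rewrite !hornerE.
have LE w : L.[w] = \prod_(j < M) (w - x * Q ^+ j).
  by rewrite /L horner_prod; apply: eq_bigr => j _; rewrite !hornerE.
have DE w : D.[w] = L.[w] - \sum_(k < M.+1) x ^+ k * qratio k * qratio (M - k) * node_prod M k w.
  rewrite /D hornerD hornerN horner_sum; congr (_ - _).
  by apply: eq_bigr => k _; rewrite hornerZ EE.
have sL : (size L <= M.+1)%N.
  by rewrite /L size_prod_XsubC /index_enum -enumT size_enum_ord.
have sE k : (k <= M)%N -> (size (E k) <= M.+1)%N.
  move=> kM; rewrite /E; apply: leq_trans (size_polyMleq _ _) _.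
  by rewrite !size_prod_XsubC /index_enum -!enumT !size_enum_ord addSn addnS /= subnKC.
have sD : (size D <= M.+1)%N.
  apply: leq_trans (size_polyD _ _) _; rewrite geq_max sL size_polyN.
  apply: leq_trans (size_sum _ _ _) _; apply/bigmax_leqP => k _.
  by apply: leq_trans (size_scale_leq _ _) _; apply: sE; rewrite -ltnS.
have rD k : (k <= M)%N -> root D (Q ^+ k).
  move=> kM; rewrite /root DE LE (bigD1 (Ordinal (kM : k < M.+1)%N)) //=.
  rewrite [X in _ - (_ + X)]big1 ?addr0 => [|i nik].
    rewrite -(big_mkord xpredT (fun j => Q ^+ k - x * Q ^+ j)) (big_cat_nat (n := k)) //=.
    rewrite big_mkord prod_below -[X in index_iota X]add0n big_addn big_mkord.
    under [X in _ * X - _]eq_bigr do rewrite addnC.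
    by rewrite prod_above /node_prod; apply/eqP; ring.
  have iM : (i <= M)%N by rewrite -ltnS.
  have nik' : (i != k :> nat) by [].
  suff -> : node_prod M i (Q ^+ k) = 0 by rewrite mulr0.
  (* The full node product vanishes at Q^k, while the extra factor Q^k - Q^i does not; so the basis
     polynomial of index i vanishes there. *)
  have/eqP := node_prodM (Q ^+ k) iM.
  rewrite [X in _ == X](bigD1 (Ordinal (kM : k < M.+1)%N)) //= subrr mul0r mulf_eq0.
  case/orP => /eqP // /subr0_eq /Q_inj ki.
  by rewrite ki eqxx in nik'.
have D0 : D = 0.
  apply/eqP; apply: contraLR sD => D0; rewrite -ltnNge.
  have:= max_poly_roots D0 (rs := [seq Q ^+ k | k <- iota 0 M.+1]).
  rewrite size_map size_iota; apply.
    by apply/allP => _ /mapP[k + ->]; rewrite mem_iota add0n ltnS => /rD.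
  by rewrite map_inj_uniq ?iota_uniq.
by apply/eqP; rewrite -subr_eq0 -LE -DE D0 horner0.
Qed.

(* Interpolation with M = 2(n+1) at the point z = Q^(n+1) / y. *)
Lemma finite_kronecker (y s : R) (n : nat) : x = y * s -> x != 0 ->
  (forall i, 1 - y * Q ^+ i \is a GRing.unit) ->
  (forall i, 1 - y * s ^+ 2 * Q ^+ i \is a GRing.unit) ->
  \prod_(i < n.+1) (1 - x * y * Q ^+ i) * \prod_(i < n.+1) (1 - s * Q ^+ i) =
  \prod_(i < n.+2) (1 - y * Q ^+ i) * \prod_(i < n.+1) (1 - y * s ^+ 2 * Q ^+ i) *
  (\sum_(m < n.+2) x ^+ m / (1 - y * Q ^+ m) * (qratio (n.+1 + m) * qratio (n.+1 - m))
   - \sum_(i < n.+1) x ^+ i * s / (1 - y * s ^+ 2 * Q ^+ i) *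
       (qratio (n - i) * qratio (n.+2 + i))).
Proof.
move=> xE x0 yU zU; set V := LHS; set U := _ * \prod_(i < _) _.
have s0 : s != 0 by apply: contraNneq x0 => s0; rewrite xE s0 mulr0.
have Q0 i : Q ^+ i != 0 by rewrite !expf_neq0.
(* Since x = y s and Q = x^2, z y = Q^(n+1), y s^2 = Q / y and s = Q / (x y); [s] spares all these
   divisions. *)
pose z := x * s * Q ^+ n; have zE : z = x * s * Q ^+ n by []; clearbody z.
have z0 : z != 0 by rewrite zE !mulf_neq0.
have zy : Q ^+ n.+1 = z * y.
  by rewrite exprS zE {1}/Q expr2 {2}xE; ring.
(* The factor that the full node product and the interpolated product have in common at z. *)
pose C := z ^+ n.+1 * \prod_(j < n.+1) (- Q ^+ j).
have C0 : C != 0.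
  by rewrite mulf_neq0 ?expf_neq0 //; apply/prodf_neq0 => j _; rewrite oppr_eq0.
have zlow i : (i < n.+1)%N -> z = Q ^+ (n - i) * (y * s ^+ 2 * Q ^+ i).
  move=> iN; rewrite zE -{1}(subnK (iN : (i <= n)%N)) exprD xE; ring.
have TE : \prod_(j < (n.+1 + n.+1).+1) (z - Q ^+ j) = C * z * U.
  rewrite -(big_mkord xpredT (fun j => z - Q ^+ j)) (big_cat_nat (n := n.+1)) //=; last first.
    by rewrite -addnS leq_addr.
  rewrite big_mkord -[X in index_iota X _]add0n big_addn big_mkord (_ : (n.+1 + n.+1).+1 - n.+1 = n.+2)%N; last by lia.
  rewrite (reindex_inj rev_ord_inj) /=.
  under eq_bigr => j _.
    rewrite subSS {1}(zlow _ (ltn_ord j)).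
    have -> : Q ^+ (n - j) * (y * s ^+ 2 * Q ^+ j) - Q ^+ (n - j) =
      - Q ^+ (n - j) * (1 - y * s ^+ 2 * Q ^+ j) by ring.
    over.
  under [X in _ * X = _]eq_bigr => j _.
    rewrite addnC exprD zy.
    have -> : z - z * y * Q ^+ j = z * (1 - y * Q ^+ j) by ring.
    over.
  rewrite !big_split /= prodr_const card_ord.
  rewrite /C [X in _ = _ * X * _ * _](reindex_inj rev_ord_inj) /=.
  under [X in _ = _ * X * _ * _]eq_bigr do rewrite subSS.
  by rewrite /U [z ^+ n.+2]exprSr; ring.
have VE : \prod_(j < n.+1 + n.+1) (z - x * Q ^+ j) = x ^+ n.+1 * C * V.
  rewrite -(big_mkord xpredT (fun j => z - x * Q ^+ j)) (big_cat_nat (n := n.+1)) //=; last first.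
    by rewrite leq_addr.
  rewrite big_mkord -[X in index_iota X _]add0n big_addn big_mkord (_ : n.+1 + n.+1 - n.+1 = n.+1)%N; last by lia.
  rewrite (reindex_inj rev_ord_inj) /=.
  under eq_bigr => j _.
    rewrite subSS {1}(zlow _ (ltn_ord j)).
    have -> : Q ^+ (n - j) * (y * s ^+ 2 * Q ^+ j) - x * Q ^+ (n - j) =
      x * (- Q ^+ (n - j) * (1 - s * Q ^+ j)) by rewrite xE; ring.
    over.
  under [X in _ * X = _]eq_bigr => j _.
    rewrite addnC exprD zy.
    have -> : z - x * (z * y * Q ^+ j) = z * (1 - x * y * Q ^+ j) by ring.
    over.
  rewrite !big_split /= !prodr_const !card_ord.
  rewrite /C [X in _ = _ * (_ * X) * _](reindex_inj rev_ord_inj) /=.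
  under [X in _ = _ * (_ * X) * _]eq_bigr do rewrite subSS.
  by rewrite /V; ring.
(* A basis polynomial is the full product [TE] divided by z - Q^k: here k = n + 1 + m, and k = n - i
   in [Elow]. *)
have Ehigh m : (m < n.+2)%N ->
    node_prod (n.+1 + n.+1) (n.+1 + m) z = C * U / (1 - y * Q ^+ m).
  move=> mN; apply: canRL (mulrK (yU m)) _; apply: (mulIf z0).
  rewrite -[RHS]mulrA [U * z]mulrC mulrA -TE -(@node_prodM _ (n.+1 + m)) ?leq_add2l //.
  by rewrite exprD zy; ring.
(* Q = x^2 again: x^(n-i) z / Q^(n-i) = x^(n-i) x s Q^i = x^(n+1) x^i s. *)
have Elow i : (i < n.+1)%N ->
    x ^+ (n - i) * node_prod (n.+1 + n.+1) (n - i) z =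
    - (x ^+ n.+1 * C * U * (x ^+ i * s / (1 - y * s ^+ 2 * Q ^+ i))).
  move=> iN; rewrite (_ : - _ = - (x ^+ n.+1 * C * U * (x ^+ i * s)) / (1 - y * s ^+ 2 * Q ^+ i)); last by ring.
  apply: canRL (mulrK (zU i)) _.
  apply: (mulIf (Q0 (n - i)%N)).
  have /(congr1 (fun t => - x ^+ (n - i) * t)) :=
    @node_prodM (n.+1 + n.+1) (n - i) z (leq_trans (leq_subr _ _) (leqW (leq_addr _ _))).
  rewrite TE {2}(zlow _ iN) => H.
  transitivity (- x ^+ (n - i) * (C * z * U)); last first.
    rewrite zE -{2 3}(subnK (iN : (i <= n)%N)) -addSn !exprD exprS.
    have -> : Q ^+ i = x ^+ i * x ^+ i by rewrite -exprMn -expr2.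
    ring.
  by rewrite -H; ring.
have := interpolation (n.+1 + n.+1) z; rewrite VE => H.
apply: (mulfI (mulf_neq0 (expf_neq0 n.+1 x0) C0)); rewrite H {H}.
(* Nodes with k > n give the first sum, with m = k - n - 1; nodes with k <= n give the second, with
   i = n - k. *)
rewrite -(big_mkord xpredT (fun k => x ^+ k * qratio k * qratio (n.+1 + n.+1 - k) *
  node_prod (n.+1 + n.+1) k z)) (big_cat_nat (n := n.+1)) //=; last first.
  by rewrite -addnS leq_addr.
rewrite big_mkord -[X in index_iota X _]add0n big_addn big_mkord (_ : (n.+1 + n.+1).+1 - n.+1 = n.+2)%N; last by lia.
rewrite (reindex_inj rev_ord_inj) /= mulrA mulrBr addrC !mulr_sumr -sumrN.
congr (_ + _); apply: eq_bigr => [[i iN]] _ /=.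
  rewrite addnC Ehigh // subnDl exprD; ring.
have -> : (n.+1 + n.+1 - (n.+1 - i.+1) = n.+2 + i)%N by lia.
rewrite subSS mulrAC -mulrA mulrAC mulrA -[x ^+ (n - i) * _ * _]mulrA.
rewrite [qratio _ * _]mulrC mulrA Elow //; ring.
Qed.
End FiniteKronecker.

(** * Power series over a domain form a domain, as interpolation requires *)

Section FpsIntegral.
Context (R : idomainType).
Implicit Types a b : fps R.

Lemma fps_leading a : a != 0 ->
  exists2 m, a m != 0 & forall i, (i < m)%N -> a i = 0.
Proof.
move=> a0; have [m am] : exists m, a m != 0.
  apply: boolp.contrapT => H; move/negP: a0; apply; apply/eqP/fpsP => m.
  by apply/eqP; apply: boolp.contrapT => /negP am; apply: H; exists m.
have ex : exists m, a m != 0 by exists m.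
exists (ex_minn ex); first by case: ex_minnP.
case: ex_minnP => k _ kmin i ik; apply/eqP; apply: contraLR ik => ai.
by rewrite -leqNgt kmin.
Qed.

(** If the leading indices are m and n, the coefficient of index m + n of the product is the single
    term a_m b_n. *)
Fact fps_mulf_eq0 a b : a * b = 0 -> (a == 0) || (b == 0).
Proof.
move=> ab0; apply: contra_eqT ab0; rewrite negb_or => /andP[a0 b0].
have [m am ma] := fps_leading a0; have [n bn nb] := fps_leading b0.
apply/eqP => /(congr1 (fun c : fps R => c (m + n)%N)); apply/eqP.
rewrite fps_coefM (bigD1 (inord m)) //= big1 ?addr0 => [|i].
  by rewrite inordK ?ltnS ?leq_addr // addKn mulf_neq0.
rewrite -val_eqE /= inordK ?ltnS ?leq_addr //.
case: ltngtP => // im _; first by rewrite ma ?mul0r.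
by rewrite nb ?mulr0 //; have := ltn_ord i; lia.
Qed.

HB.instance Definition _ := GRing.ComUnitRing_isIntegral.Build (fps R) fps_mulf_eq0.
End FpsIntegral.

(** * The indeterminate and congruences modulo its powers *)

Section FpsCongruence.
Context (R : comUnitRingType).
Implicit Types (a b c d : fps R) (p : {poly R}).

Definition fps_of_poly p : fps R := Fps (fun n => p`_n).

Fact fps_of_poly_is_zmod_morphism : zmod_morphism fps_of_poly.
Proof. by move=> p r; apply: fpsP => n; rewrite /= coefB. Qed.
Fact fps_of_poly_is_monoid_morphism : monoid_morphism fps_of_poly.
Proof.
split; first by apply: fpsP => n; rewrite fps_coef1 /= coef1.
by move=> p r; apply: fpsP => n; rewrite fps_coefM /= coefM.
Qed.
HB.instance Definition _ :=
  GRing.isZmodMorphism.Build {poly R} (fps R) fps_of_poly fps_of_poly_is_zmod_morphism.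
HB.instance Definition _ :=
  GRing.isMonoidMorphism.Build {poly R} (fps R) fps_of_poly fps_of_poly_is_monoid_morphism.

Definition fpsX : fps R := fps_of_poly 'X.

Lemma fps_coefXn k n : (fpsX ^+ k) n = (n == k)%:R.
Proof. by rewrite -rmorphXn /= coefXn. Qed.

Lemma fps_coefXnM k a n : (fpsX ^+ k * a) n = if (n < k)%N then 0 else a (n - k)%N.
Proof.
rewrite fps_coefM; case: ltnP => nk.
  by rewrite big1 // => i _; rewrite fps_coefXn (_ : (i : nat) == k = false) ?mul0r //; have := ltn_ord i; lia.
rewrite (bigD1 (Ordinal (nk : k < n.+1)%N)) //= fps_coefXn eqxx mul1r big1 ?addr0 // => i.
by rewrite -val_eqE fps_coefXn /= => /negPf ->; rewrite mul0r.
Qed.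

Lemma fpsX_neq0 : fpsX != 0.
Proof.
by apply/eqP => /(congr1 (fun a : fps R => a 1%N)) /eqP; rewrite -[fpsX]expr1 fps_coefXn oner_eq0.
Qed.

Lemma fpsXn_inj : injective (fun k => fpsX ^+ k).
Proof.
move=> k l /(congr1 (fun a : fps R => a k)) /eqP; rewrite !fps_coefXn eqxx.
by case: (k =P l) => // _; rewrite oner_eq0.
Qed.

Lemma one_subXn_unit k : (0 < k)%N -> 1 - fpsX ^+ k \is a GRing.unit.
Proof. by rewrite fps_unitE fps_coefB fps_coef1 fps_coefXn; case: k => // k _; rewrite subr0 unitr1. Qed.

(* Congruence modulo the N-th power of the indeterminate. *)
Definition eqmod (N : nat) a b := forall n, (n < N)%N -> a n = b n.

Lemma eqmod_refl N a : eqmod N a a. Proof. by []. Qed.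
Lemma eqmod_sym N a b : eqmod N a b -> eqmod N b a.
Proof. by move=> ab n nN; rewrite ab. Qed.
Lemma eqmod_trans N b a c : eqmod N a b -> eqmod N b c -> eqmod N a c.
Proof. by move=> ab bc n nN; rewrite ab ?bc. Qed.
Lemma eqmodD N a b c d : eqmod N a b -> eqmod N c d -> eqmod N (a + c) (b + d).
Proof. by move=> ab cd n nN; rewrite !fps_coefD ab ?cd. Qed.
Lemma eqmodM N a b c d : eqmod N a b -> eqmod N c d -> eqmod N (a * c) (b * d).
Proof.
move=> ab cd n nN; rewrite !fps_coefM; apply: eq_bigr => i _.
by rewrite ab ?cd ?(leq_ltn_trans (leq_subr _ _)) // (leq_ltn_trans _ nN) // -ltnS.
Qed.
Lemma eqmodMl N c a b : eqmod N a b -> eqmod N (c * a) (c * b).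
Proof. exact/eqmodM/eqmod_refl. Qed.
Lemma eqmodMr N c a b : eqmod N a b -> eqmod N (a * c) (b * c).
Proof. by move=> ab; apply: eqmodM (@eqmod_refl _ _). Qed.
(** A factor of order k saves k orders of precision; this makes up for [qratio] being evaluated at
    small indices in the tails of the sums. *)
Lemma eqmodXnM N k a b : eqmod (N - k) a b -> eqmod N (fpsX ^+ k * a) (fpsX ^+ k * b).
Proof.
by move=> ab n nN; rewrite !fps_coefXnM; case: ltnP => // kn; rewrite ab // ltn_sub2r // (leq_ltn_trans kn).
Qed.
Lemma eqmod_sum N (I : Type) (r : seq I) (P : pred I) (F G : I -> fps R) :
  (forall i, P i -> eqmod N (F i) (G i)) ->
  eqmod N (\sum_(i <- r | P i) F i) (\sum_(i <- r | P i) G i).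
Proof. by move=> FG n nN; rewrite !fps_coef_sum; apply: eq_bigr => i /FG ->. Qed.
Lemma eqmod_unitMl N a b c : c \is a GRing.unit -> eqmod N (c * a) (c * b) -> eqmod N a b.
Proof. by move=> cU /(@eqmodMl _ c^-1); rewrite !mulKr. Qed.

End FpsCongruence.

(** * Truncated products and their dissection modulo 6 *)

Section FiniteProducts.
Context (R : comNzRingType).
Implicit Types t u : R.

(** The Pochhammer symbols (t;t)_N and (-t;t^2)_N. *)
Definition euler_fin t (N : nat) := \prod_(i < N) (1 - t ^+ i.+1).
Definition odd_fin t (N : nat) := \prod_(i < N) (1 + t ^+ i.*2.+1).

Lemma euler_finS t N : euler_fin t N.+1 = euler_fin t N * (1 - t ^+ N.+1).
Proof. exact: big_ord_recr. Qed.
Lemma odd_finS t N : odd_fin t N.+1 = odd_fin t N * (1 + t ^+ N.*2.+1).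
Proof. exact: big_ord_recr. Qed.

(* The finite form of (-t;t^2) = f_2^2 / (f_1 f_4), denominators cleared. *)
Lemma odd_finE t N :
  odd_fin t N * (euler_fin t N.*2 * euler_fin (t ^+ 4) N) =
  euler_fin (t ^+ 2) N * euler_fin (t ^+ 2) N.*2.
Proof.
elim: N => [|N IHN]; first by rewrite /odd_fin /euler_fin !big_ord0 !mulr1.
rewrite doubleS odd_finS !euler_finS.
have -> : t ^+ 4 ^+ N.+1 = t ^+ N.*2.+2 ^+ 2 by rewrite -!exprM; congr (_ ^+ _); lia.
have -> : t ^+ 2 ^+ N.+1 = t ^+ N.*2.+2 by rewrite -!exprM; congr (_ ^+ _); lia.
have -> : t ^+ 2 ^+ N.*2.+1 = t ^+ N.*2.+1 ^+ 2 by rewrite -!exprM; congr (_ ^+ _); lia.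
have -> : t ^+ 2 ^+ N.*2.+2 = t ^+ N.*2.+2 ^+ 2 by rewrite -!exprM; congr (_ ^+ _); lia.
(* With a = t^(2N+1) and b = t^(2N+2), both sides gain the factor (1 - b)(1 - a^2)(1 - b^2). *)
move: (t ^+ N.*2.+1) (t ^+ N.*2.+2) => a b.
transitivity (odd_fin t N * (euler_fin t N.*2 * euler_fin (t ^+ 4) N) *
  ((1 - b) * (1 - a ^+ 2) * (1 - b ^+ 2))); first by ring.
by rewrite IHN; ring.
Qed.

(** The odd exponents below 6N, sorted into the residues 5, 1, 3 modulo 6. *)
Lemma odd_fin3 t N :
  \prod_(i < N) (1 + t ^+ (6 * i + 5)) * \prod_(i < N) (1 + t ^+ (6 * i + 1)) * odd_fin (t ^+ 3) N =
  odd_fin t (3 * N).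
Proof.
elim: N => [|N IHN]; first by rewrite /odd_fin muln0 !big_ord0 !mulr1.
rewrite mulnS !odd_finS -IHN !big_ord_recr /=.
rewrite (_ : t ^+ 3 ^+ _ = t ^+ (3 * N).+1.*2.+1); last by rewrite -exprM; congr (_ ^+ _); lia.
rewrite (_ : (6 * N + 5 = (3 * N).+2.*2.+1)%N); last by lia.
rewrite (_ : (6 * N + 1 = (3 * N).*2.+1)%N); last by lia.
by ring.
Qed.

(** The positive even exponents up to 6N, sorted into the residues 2, 4, 0 modulo 6. *)
Lemma euler_fin3 t N :
  \prod_(i < N) (1 - t ^+ (6 * i + 2)) * \prod_(i < N) (1 - t ^+ (6 * i + 4)) * euler_fin (t ^+ 6) N =
  euler_fin (t ^+ 2) (3 * N).
Proof.
elim: N => [|N IHN]; first by rewrite /euler_fin muln0 !big_ord0 !mulr1.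
rewrite mulnS !euler_finS -IHN !big_ord_recr /=.
rewrite (_ : t ^+ 6 ^+ _ = t ^+ 2 ^+ (3 * N).+3); last by rewrite -!exprM; congr (_ ^+ _); lia.
rewrite (_ : t ^+ (6 * N + 2) = t ^+ 2 ^+ (3 * N).+1); last by rewrite -!exprM; congr (_ ^+ _); lia.
rewrite (_ : t ^+ (6 * N + 4) = t ^+ 2 ^+ (3 * N).+2); last by rewrite -!exprM; congr (_ ^+ _); lia.
by ring.
Qed.
End FiniteProducts.

(** * The q-adic limit and the Lambert series of the generating function *)

Section LambertSeries.
Local Notation q := (fpsX int).

(** The omitted factors 1 - q^(n j), j > N, only affect indices above N. *)
Lemma eulerf_eqmod n K N : (0 < n)%N -> (K <= N.+1)%N ->
  eqmod K (eulerf n) (euler_fin (q ^+ n) N).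
Proof.
move=> n0 KN m mK; rewrite (@eulerf_coef n m N) //; last by rewrite -ltnS (leq_trans mK).
transitivity (fps_of_poly (euler_prod n N) m) => //; congr (fps_coef _ m).
rewrite /euler_prod big_add1 big_mkord rmorph_prod; apply: eq_bigr => i _.
by rewrite rmorphB rmorph1 !rmorphXn /= exprM.
Qed.

Lemma odd_fin_eqmod k K N : (0 < k)%N -> (K <= N.+1)%N ->
  eqmod K (odd_fin (q ^+ k) N * (eulerf k * eulerf (4 * k))) (eulerf (2 * k) ^+ 2).
Proof.
move=> k0 KN; have KN2 : (K <= N.*2.+1)%N by lia.
apply: (@eqmod_trans _ _ (odd_fin (q ^+ k) N * (euler_fin (q ^+ k) N.*2 * euler_fin (q ^+ (4 * k)) N))).
  by apply: eqmodMl; apply: eqmodM; apply: eulerf_eqmod; rewrite ?muln_gt0.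
rewrite (mulnC 4) exprM odd_finE -exprM (mulnC k) expr2.
by apply/eqmod_sym/eqmodM; apply: eulerf_eqmod; rewrite ?muln_gt0.
Qed.

Local Notation A := (qratio (- q ^+ 3)).

(** In the limit, (-q^3;q^6) / (q^6;q^6) = f_6^2 / (f_3 f_12) / f_6, by [odd_fin_eqmod] at k = 3. *)
Lemma qratio_eqmod K N : (K <= N.+1)%N -> eqmod K (A N * (eulerf 3 * eulerf 12)) (eulerf 6).
Proof.
move=> KN; apply: (@eqmod_unitMl _ _ _ _ (eulerf 6)); first exact: eulerf_unit.
have AE : A N * euler_fin (q ^+ 6) N = odd_fin (q ^+ 3) N.
  rewrite /qratio /euler_fin -big_split; apply: eq_bigr => i _ /=.
  rewrite sqrrN -[q ^+ 3 ^+ 2]exprM divrK; last by rewrite -exprM one_subXn_unit.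
  by rewrite mulNr opprK -!exprM -exprD; congr (1 + _ ^+ _); lia.
apply: (@eqmod_trans _ _ (A N * euler_fin (q ^+ 6) N * (eulerf 3 * eulerf 12))).
  by rewrite mulrA [eulerf 6 * _]mulrC; apply/eqmodMr/eqmodMl/eulerf_eqmod.
by rewrite AE -expr2; apply: (@odd_fin_eqmod 3).
Qed.

(** The case x = - q^3, y = q^2, s = - q, so that Q = q^6, x y = - q^5 and y s^2 = q^4; the sign of
    s turns the difference of sums into a sum. *)
Lemma finite_kronecker_q n :
  \prod_(i < n.+1) (1 + q ^+ (6 * i + 5)) * \prod_(i < n.+1) (1 + q ^+ (6 * i + 1)) =
  \prod_(i < n.+2) (1 - q ^+ (6 * i + 2)) * \prod_(i < n.+1) (1 - q ^+ (6 * i + 4)) *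
  (\sum_(m < n.+2) (-1) ^+ m *
     (q ^+ (3 * m) * ((1 - q ^+ (6 * m + 2))^-1 * (A (n.+1 + m) * A (n.+1 - m)))) +
   \sum_(i < n.+1) (-1) ^+ i *
     (q ^+ (3 * i + 1) * ((1 - q ^+ (6 * i + 4))^-1 * (A (n - i) * A (n.+2 + i))))).
Proof.
have QE i : (- q ^+ 3) ^+ 2 ^+ i = q ^+ (6 * i).
  by rewrite sqrrN -!exprM; congr (_ ^+ _); lia.
have yE i : q ^+ 2 * (- q ^+ 3) ^+ 2 ^+ i = q ^+ (6 * i + 2).
  by rewrite QE -exprD addnC.
have ysE i : q ^+ 2 * (- q) ^+ 2 * (- q ^+ 3) ^+ 2 ^+ i = q ^+ (6 * i + 4).
  by rewrite QE sqrrN -!exprD; congr (_ ^+ _); lia.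
have xyE i : 1 - - q ^+ 3 * q ^+ 2 * (- q ^+ 3) ^+ 2 ^+ i = 1 + q ^+ (6 * i + 5).
  by rewrite QE !mulNr opprK -!exprD addnC.
have sE i : 1 - - q * (- q ^+ 3) ^+ 2 ^+ i = 1 + q ^+ (6 * i + 1).
  by rewrite QE mulNr opprK addn1 exprS.
have QU i : 1 - (- q ^+ 3) ^+ 2 ^+ i.+1 \is a GRing.unit by rewrite QE one_subXn_unit.
have Q_inj : injective (fun i => (- q ^+ 3) ^+ 2 ^+ i) by move=> i j; rewrite !QE => /fpsXn_inj; lia.
have x0 : - q ^+ 3 != 0 by rewrite oppr_eq0 expf_neq0 // fpsX_neq0.
have xE : - q ^+ 3 = q ^+ 2 * - q by rewrite mulrN -exprSr.
have yU i : 1 - q ^+ 2 * (- q ^+ 3) ^+ 2 ^+ i \is a GRing.unit.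
  by rewrite yE one_subXn_unit // addn2.
have zU i : 1 - q ^+ 2 * (- q) ^+ 2 * (- q ^+ 3) ^+ 2 ^+ i \is a GRing.unit.
  by rewrite ysE one_subXn_unit // addn4.
have := finite_kronecker QU Q_inj n xE x0 yU zU.
under eq_bigr do rewrite xyE.
under [X in _ * X = _ -> _]eq_bigr do rewrite sE.
move=> ->.
under [X in X * _ * _ = _]eq_bigr do rewrite yE.
under [X in _ * X * _ = _]eq_bigr do rewrite ysE.
congr (_ * _); rewrite -sumrN; congr (_ + _); apply: eq_bigr => i _.
  by rewrite yE -[- q ^+ 3]mulN1r exprMn -exprM !mulrA.
by rewrite ysE -[- q ^+ 3]mulN1r exprMn -exprM [q ^+ (3 * i + 1)]exprD; ring.
Qed.

(** The bracket of [finite_kronecker_q] without the products of two values of [A], each of which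
    tends to (f_6 / (f_3 f_12))^2. *)
Definition lambert_fin N : fps int :=
  \sum_(m < N.+1) (-1) ^+ m * (q ^+ (3 * m) * (1 - q ^+ (6 * m + 2))^-1) +
  \sum_(i < N) (-1) ^+ i * (q ^+ (3 * i + 1) * (1 - q ^+ (6 * i + 4))^-1).

Lemma b3bar_gf_lambert n : eqmod n.+2 b3bar_gf (lambert_fin n.+1).
Proof.
set F3 := eulerf 3 * eulerf 12.
have FU k := eulerf_unit k.
(* [A k] is only known to precision k + 1, which falls short when k = n + 1 - m or n - i; the power
   q^(3m) or q^(3i+1) in front supplies the rest. *)
have AE k l m (c : fps int) : (n.+2 <= m + k.+1)%N -> (n.+2 <= m + l.+1)%N ->
    eqmod n.+2 (q ^+ m * (c * (A k * A l)) * F3 ^+ 2) (q ^+ m * c * eulerf 6 ^+ 2).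
  move=> mk ml; rewrite -!mulrA; apply: eqmodXnM; apply: eqmodMl.
  rewrite !expr2 (_ : A k * _ = A k * F3 * (A l * F3)); last by ring.
  by apply: eqmodM; apply: qratio_eqmod; lia.
pose V : fps int := \prod_(i < n.+1) (1 + q ^+ (6 * i + 5)) * \prod_(i < n.+1) (1 + q ^+ (6 * i + 1)).
pose U : fps int := \prod_(i < n.+2) (1 - q ^+ (6 * i + 2)) * \prod_(i < n.+1) (1 - q ^+ (6 * i + 4)).
have VUL : eqmod n.+2 (V * F3 ^+ 2) (U * (lambert_fin n.+1 * eulerf 6 ^+ 2)).
  rewrite [V]finite_kronecker_q -/U -mulrA; apply: eqmodMl.
  rewrite /lambert_fin !mulrDl !mulr_suml.
  by apply: eqmodD; apply: eqmod_sum => -[i iN] _ /=; rewrite -!(mulrA ((-1) ^+ i));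
    apply: eqmodMl; apply: AE; lia.
have UE : eqmod n.+2 (U * eulerf 6) (eulerf 2).
  apply: (@eqmod_trans _ _ (U * euler_fin (q ^+ 6) n.+1)).
    by apply: eqmodMl; apply: eulerf_eqmod.
  (* The first product of U has one factor more than the second; its exponent 6(n+1) + 2 lies beyond
     the precision. *)
  rewrite /U big_ord_recr /= (_ : _ * _ = euler_fin (q ^+ 2) (3 * n.+1) * (1 - q ^+ (6 * n.+1 + 2))).
    apply: (@eqmod_trans _ _ (euler_fin (q ^+ 2) (3 * n.+1) * 1)).
      apply: eqmodMl => k kn; rewrite fps_coefB fps_coefXn (_ : k == _ = false) ?subr0 //; lia.
    by rewrite mulr1; apply/eqmod_sym/eulerf_eqmod => //; lia.
  by rewrite -euler_fin3; ring.
(* V (-q^3;q^6) tends to (-q;q^2) = f_2^2 / (f_1 f_4), and f_6^2 stands for (-q^3;q^6) f_3 f_12. *)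
have VE : eqmod n.+2 (V * (eulerf 1 * eulerf 4) * eulerf 6 ^+ 2) (eulerf 2 ^+ 2 * F3).
  have H3 : eqmod n.+2 (odd_fin (q ^+ 3) n.+1 * F3) (eulerf 6 ^+ 2).
    exact: (@odd_fin_eqmod 3).
  apply: eqmod_trans (eqmodMl _ (eqmod_sym H3)) _.
  rewrite (_ : _ * (_ * F3) = V * odd_fin (q ^+ 3) n.+1 * (eulerf 1 * eulerf 4) * F3); last by ring.
  rewrite [V * _]odd_fin3; apply: eqmodMr.
  by have := @odd_fin_eqmod 1 n.+2 (3 * n.+1) isT; rewrite expr1; apply; lia.
have DU : eulerf 1 * eulerf 4 * eulerf 6 ^+ 3 \is a GRing.unit.
  by rewrite !unitrM !FU.
(* After multiplication by f_2 and the denominator, [VE], [VUL] and [UE] are applied in turn. *)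
apply: (eqmod_unitMl (FU 2%N)); apply: (eqmod_unitMl DU).
rewrite mulrCA /b3bar_gf [_ * (_ / _)]mulrC divrK //.
rewrite (_ : eulerf 2 * (_ * _) = eulerf 2 ^+ 2 * F3 * F3 ^+ 2); last by rewrite /F3; ring.
apply: eqmod_trans (eqmodMr _ (eqmod_sym VE)) _.
rewrite (_ : _ * F3 ^+ 2 = eulerf 1 * eulerf 4 * eulerf 6 ^+ 2 * (V * F3 ^+ 2)); last by ring.
apply: eqmod_trans (eqmodMl _ VUL) _.
rewrite (_ : _ * (U * _) = eulerf 1 * eulerf 4 * eulerf 6 ^+ 3 * (U * eulerf 6 * lambert_fin n.+1)).
  by apply: eqmodMl; apply: eqmodMr.
by ring.
Qed.

(** The series is the sum of q^(d k) over odd k. Multiplying back, the indices m and m - 2d cancel,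
    and below 2d only k = 1 is left. *)
Lemma coef_odd_geometric d n : (0 < d)%N ->
  (q ^+ d / (1 - q ^+ (2 * d))) n = ((d %| n)%N && odd (n %/ d)%N)%:R.
Proof.
move=> d0; pose H : fps int := Fps (fun n => ((d %| n)%N && odd (n %/ d)%N)%:R).
have dU : 1 - q ^+ (2 * d) \is a GRing.unit by rewrite one_subXn_unit // muln_gt0.
suff -> : q ^+ d = H * (1 - q ^+ (2 * d)) by rewrite mulrK.
apply: fpsP => m; rewrite mulrC mulrBl mul1r fps_coefB fps_coefXnM fps_coefXn /=.
have [md|dm] := ltnP m (2 * d).
  rewrite subr0; case: (boolP (d %| m)%N) => [/dvdnP[k mk]|].
    move: md; rewrite mk mulnK // ltn_pmul2r // -[X in _ == X]mul1n eqn_pmul2r //.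
    by case: k {mk} => [|[]].
  by apply: contraNeq; rewrite eq_sym; case: (m =P d) => // -> _; rewrite dvdnn.
have -> : (m == d) = false by lia.
rewrite -{1 2}(subnK dm) dvdn_addl ?dvdn_mull // divnDr ?dvdn_mull // mulnK // oddD addbF.
by rewrite subrr.
Qed.

Lemma fps_coef_signM (a : fps int) m n : ((-1) ^+ m * a) n = (-1) ^+ m * a n.
Proof.
rewrite -signr_odd -[in RHS]signr_odd.
by case: odd; rewrite ?mul1r // expr1 !mulN1r fps_coefN.
Qed.

(** * The divisor sum of the character modulo 3, and the coefficients in terms of it *)

Definition chi3 (d : nat) : int := if (d %% 3 == 1)%N then 1 else if (d %% 3 == 2)%N then -1 else 0.

Lemma chi3M a b : chi3 (a * b) = chi3 a * chi3 b.
Proof.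
rewrite /chi3 -modnMm; have := ltn_pmod a (isT : 0 < 3)%N; have := ltn_pmod b (isT : 0 < 3)%N.
by case: (a %% 3)%N => [|[|[]]] //; case: (b %% 3)%N => [|[|[]]].
Qed.

Definition chi3_sum (n : nat) : int := \sum_(d <- divisors n) (odd (n %/ d)%N)%:R * chi3 d.

(** The divisors of p n are the d and the p d with d dividing n. Their cofactors p n / d and n / d
    have the same parity as p is odd, and the values of the character are chi(d) and chi(p)
    chi(d). *)
Lemma chi3_sumM p n : prime p -> odd p -> coprime p n -> (0 < n)%N ->
  chi3_sum (p * n) = (1 + chi3 p) * chi3_sum n.
Proof.
move=> pp podd pn n0; have p0 := prime_gt0 pp.
have dE : perm_eq (divisors (p * n)) (divisors n ++ [seq (p * d)%N | d <- divisors n]).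
  apply: uniq_perm; first exact: divisors_uniq.
    rewrite cat_uniq divisors_uniq map_inj_uniq ?divisors_uniq ?andbT => [|a b /eqP]; last first.
      by rewrite eqn_pmul2l // => /eqP.
    apply/hasPn => _ /mapP[d _ ->]; rewrite -dvdn_divisors //; apply/negP => pd.
    move: pn; rewrite prime_coprime // => /negP; apply.
    by apply: dvdn_trans pd; apply: dvdn_mulr.
  move=> d; rewrite mem_cat -!dvdn_divisors ?muln_gt0 ?p0 //.
  apply/idP/orP => [dpn|[dn|/mapP[e en ->]]]; last 2 first.
  - exact: dvdn_mull.
  - by rewrite dvdn_pmul2l // dvdn_divisors.
  have [pd|pd] := boolP (p %| d)%N; last first.
    by left; move: dpn; rewrite Gauss_dvdr // coprime_sym prime_coprime.
  right; have /dvdnP[e dE] := pd; apply/mapP; exists e; last by rewrite mulnC.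
  by rewrite -dvdn_divisors // -(dvdn_pmul2l p0) mulnC -dE.
rewrite /chi3_sum (perm_big _ dE) big_cat big_map /= mulrDl mul1r mulr_sumr.
congr (_ + _); apply: eq_big_seq => d; rewrite -dvdn_divisors // => dn.
  by rewrite -muln_divA // oddM podd.
by rewrite divnMl // chi3M mulrCA.
Qed.

(** The primes are split off one at a time; their distinctness makes each coprime to the product of
    the others, as [chi3_sumM] demands. *)
Lemma dvd_chi3_sum (s : seq nat) n : uniq s -> (0 < n)%N ->
  {in s, forall p, [/\ prime p, odd p, coprime p 3 & coprime p n]} ->
  (2%:Z ^+ size s %| chi3_sum (\prod_(p <- s) p * n))%Z.
Proof.
move=> + n0; elim: s => [|p s IHs] /=; first by rewrite dvd1z.
case/andP=> ps us H; have [pp podd p3 pn] := H p (mem_head _ _).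
have Hs : {in s, forall r, [/\ prime r, odd r, coprime r 3 & coprime r n]}.
  by move=> r rs; apply: H; rewrite inE rs orbT.
rewrite big_cons -mulnA chi3_sumM //.
- rewrite exprS; apply: dvdz_mul (IHs us Hs).
  (* As p is 1 or 2 modulo 3, the factor 1 + chi(p) is 2 or 0. *)
  move: p3; rewrite coprime_sym prime_coprime // /dvdn /chi3.
  by case: (p %% 3)%N (ltn_pmod p (isT : 0 < 3)%N) => [|[|[]]].
- rewrite coprimeMr pn andbT big_seq; elim/big_ind: _ => [|a b pa pb|r rs].
  + exact: coprimen1.
  + by rewrite coprimeMr pa.
  + have [pr _ _ _] := Hs r rs; rewrite prime_coprime // dvdn_prime2 //.
    by apply: contra ps => /eqP ->.
- rewrite muln_gt0 n0 andbT big_seq; apply: prodn_cond_gt0 => r rs.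
  by have [/prime_gt0] := Hs r rs.
Qed.

(** The two progressions match the two sums of [lambert_fin]. *)
Lemma sum_chi3 (F : nat -> int) N :
  \sum_(d < 3 * N) F d * chi3 d = \sum_(m < N) F (3 * m + 1)%N - \sum_(i < N) F (3 * i + 2)%N.
Proof.
elim: N => [|N IHN]; first by rewrite muln0 !big_ord0 subr0.
rewrite mulnS !big_ord_recr /= IHN.
have -> : chi3 (3 * N) = 0 by rewrite /chi3 modnMr.
have -> : chi3 (3 * N).+1 = 1 by rewrite /chi3 -addn1 mulnC modnMDl.
have -> : chi3 (3 * N).+2 = -1 by rewrite /chi3 -addn2 mulnC modnMDl.
by rewrite addn1 addn2; ring.
Qed.

Lemma b3bar_gfE n : b3bar_gf n = (-1) ^+ n * chi3_sum n.+1.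
Proof.
pose F d : int := ((d %| n.+1)%N && odd (n.+1 %/ d)%N)%:R.
rewrite (@b3bar_gf_lambert n) //.
(* Multiplying by q turns the terms into q^d / (1 - q^(2d)) with d = 3m + 1 or d = 3i + 2. *)
have -> : lambert_fin n.+1 n = (q ^+ 1 * lambert_fin n.+1) n.+1 by rewrite fps_coefXnM subn1.
(* If (n+1) / d is odd, d and n + 1 have the same parity; otherwise F d = 0. *)
have sgnF d : (-1) ^+ d.+1 * F d = (-1) ^+ n * F d.
  rewrite /F; case: (boolP (_ && _)) => [/andP[dn od]|]; last by rewrite !mulr0.
  congr (_ * _); rewrite -signr_odd -[RHS]signr_odd; congr (_ ^+ nat_of_bool _).
  by have := congr1 odd (divnK dn); rewrite oddM od /= => ->; rewrite negbK.
have F0 d : (n.+1 < d)%N -> F d = 0.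
  by move=> nd; rewrite /F gtnNdvd.
(* The bound 3(n+1) exceeds every divisor of n + 1 and has the form that [sum_chi3] needs. *)
have -> : chi3_sum n.+1 = \sum_(d < 3 * n.+1) F d * chi3 d.
  rewrite -(big_mkord xpredT (fun d => F d * chi3 d)) /chi3_sum.
  transitivity (\sum_(d <- index_iota 0 (3 * n.+1) | (d %| n.+1)%N) F d * chi3 d).
    rewrite -[RHS]big_filter (perm_big [seq d <- index_iota 0 (3 * n.+1) | (d %| n.+1)%N]).
      by rewrite !big_filter; apply: eq_bigr => d dn; rewrite /F dn.
    apply: uniq_perm; rewrite ?divisors_uniq ?filter_uniq ?iota_uniq // => d.
    rewrite -dvdn_divisors // mem_filter mem_index_iota.
    case: (boolP (d %| n.+1)%N) => // /dvdn_leq dn.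
    by rewrite (leq_ltn_trans (dn isT)) //; lia.
  by rewrite big_mkcond; apply: eq_bigr => d _; rewrite /F; case: dvdn; rewrite ?mul0r.
rewrite sum_chi3 /lambert_fin mulrDr fps_coefD !mulr_sumr mulrBr !mulr_sumr !fps_coef_sum -sumrN.
have coefE d m : (q ^+ 1 * ((-1) ^+ m * (q ^+ d * (1 - q ^+ (2 * d.+1))^-1))) n.+1 = (-1) ^+ m * F d.+1.
  by rewrite mulrCA [q ^+ 1 * _]mulrA -exprD fps_coef_signM coef_odd_geometric.
have coef1 (m : nat) : (q ^+ 1 * ((-1) ^+ m * (q ^+ (3 * m) / (1 - q ^+ (6 * m + 2))))) n.+1 =
    (-1) ^+ m * F (3 * m + 1)%N.
  by rewrite (_ : (6 * m + 2 = 2 * (3 * m).+1)%N) ?coefE ?addn1 //; lia.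
have coef2 (m : nat) : (q ^+ 1 * ((-1) ^+ m * (q ^+ (3 * m + 1) / (1 - q ^+ (6 * m + 4))))) n.+1 =
    (-1) ^+ m * F (3 * m + 2)%N.
  by rewrite (_ : (6 * m + 4 = 2 * (3 * m + 1).+1)%N) ?coefE ?addnS //; lia.
under eq_bigr => i _ do rewrite coef1.
under [X in _ + X = _]eq_bigr => i _ do rewrite coef2.
(* The surplus term of the first sum has d = 3(n+1) + 1 > n + 1. *)
rewrite big_ord_recr /= (F0 (3 * n.+1 + 1)%N) ?mulr0 ?addr0; last by lia.
have sgnE (e e' : nat) : odd e = odd e' -> (-1) ^+ e = (-1) ^+ e' :> int.
  by rewrite -signr_odd => ->; rewrite signr_odd.
(* (-1)^(d+1) is (-1)^i for d = 3i + 1 and - (-1)^i for d = 3i + 2; the latter sign cancels the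
   value -1 of the character. *)
congr (_ + _); apply: eq_bigr => i _; rewrite -sgnF.
  by congr (_ * _); apply: sgnE; lia.
by rewrite -[RHS]mulN1r mulrA -exprS; congr (_ * _); apply: sgnE; lia.
Qed.
End LambertSeries.

(** * The congruence modulo 2^v, with u = 0 *)

Theorem theorem1p7 (n : nat) :
  exists u : nat, forall (v : nat) (q : 'I_(u + v) -> nat),
    (1 <= v)%N ->
    injective q ->
    (forall i, prime (q i)) ->
    (forall i, coprime (q i) 6) ->
    (forall i, coprime n (q i)) ->
    (b3bar ((((\prod_(i < u + v) q i) * n)%N%:R - 24%:R) / 24%:R)
       = 0 %[mod 2%:Z ^+ v])%Z.
Proof.
exists 0%N => v p _ p_inj p_prime p6 np; set P := (\prod_(i < _) p i)%N.
(* Off the natural numbers the value is 0 by convention; otherwise the argument is some k with P n =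
   24 (k + 1). *)
rewrite /b3bar; case: ifP => // /Num.Theory.natrP[k kE]; rewrite kE Num.Theory.natrK.
have {kE} PnE : (P * n = 24 * k.+1)%N.
  apply/eqP; rewrite -(Num.Theory.eqr_nat rat) [X in _ == X]natrM -[k.+1%:R]natr1 -kE.
  by apply/eqP; field.
have P24 : coprime 24 P.
  rewrite /P; elim/big_ind: _ => [|a b ca cb|i _]; first exact: coprimen1.
    by rewrite coprimeMr ca.
  (* Coprimality to 6 gives coprimality to 4, a divisor of 6^2. *)
  have := p6 i; rewrite coprime_sym (_ : 24 = 6 * 4)%N // coprimeMl => c6.
  by rewrite c6 (coprime_dvdl _ (n := 6 ^ 2)) ?coprimeXl.
(* As P is coprime to 24, the factor 24 comes from n = 24 m, and k + 1 = P m is in the form of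
   [dvd_chi3_sum]. *)
have /dvdnP[m nE] : (24 %| n)%N by rewrite -(Gauss_dvdr _ P24) PnE dvdn_mulr.
have kE : (k.+1 = P * m)%N by lia.
rewrite b3bar_gfE kE; apply/eqP; rewrite eqz_mod_dvd subr0 dvdz_mull //.
pose s := [seq p i | i <- enum 'I_v].
have -> : P = \prod_(r <- s) r by rewrite /P /s big_map big_enum.
have <- : size s = v by rewrite size_map size_enum_ord.
apply: dvd_chi3_sum => [||_ /mapP[i _ ->]].
- by rewrite map_inj_uniq ?enum_uniq.
- by rewrite lt0n; apply: contra_eqN kE => /eqP ->; rewrite muln0.
have := p6 i; rewrite (_ : 6 = 2 * 3)%N // coprimeMr coprimen2 => /andP[podd p3].
split=> //; rewrite coprime_sym; apply: coprime_dvdl (np i).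
by rewrite nE dvdn_mulr.
Qed.
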